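(* Let $k$ be a positive integer and let $G$ be a graph with $n$ vertices belonging to the class $k_{\mathrm{DIR}}\text{-CONV}$. Then $G$ has at most $n^k$ (inclusion-wise) maximal cliques.
   Context: All graphs are finite and nonempty. A polygon is a closed convex polygon in $\mathbb{R}^2$. For a finite collection $R$ of sets, its intersection graph has one vertex for each member of $R$, and two distinct vertices are adjacent iff the corresponding sets have nonempty intersection. For a set $L=\{\ell_1,\dots,\ell_k\}$ of $k$ distinct lines through the origin in $\mathbb{R}^2$, $\mathcal{P}(L)$ is the family of all polygons each of whose sides is parallel to some line of $L$. The class $k_{\mathrm{DIR}(L)}\text{-CONV}$ consists of all intersection graphs of finite collections of polygons from $\mathcal{P}(L)$, and $k_{\mathrm{DIR}}\text{-CONV}$ is the union of the classes $k_{\mathrm{DIR}(L)}\text{-CONV}$ over all sets $L$ of $k$ distinct lines through the origin. *)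

(* Defs.v *)
From HB Require Import structures.
From mathcomp Require Import all_boot all_order all_algebra finmap.
From mathcomp Require Import classical_sets reals.

Set Implicit Arguments.
Unset Strict Implicit.
Unset Printing Implicit Defensive.

Import GRing.Theory Num.Theory.
Local Open Scope ring_scope.
Local Open Scope classical_set_scope.

Record sgraph := SGraph {
  vertex : finType;
  adj : rel vertex;
  adj_sym : symmetric adj;
  adj_irrefl : irreflexive adj
}.

Definition clique (G : sgraph) (S : {set vertex G}) : bool :=
  [forall x in S, forall y in S, (x != y) ==> adj x y].

Definition maximal_cliques (G : sgraph) : {set {set vertex G}} :=
  [set S | maxset (@clique G) S]%SET.

Section Plane.
Variable R : realType.

Definition plane := 'rV[R]_2.

Definition dot (u x : plane) : R := \sum_i u 0 i * x 0 i.

Definition convex_hull n (p : 'I_n -> plane) : set plane :=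
  [set x | exists c : 'I_n -> R,
    [/\ forall i, 0 <= c i, \sum_i c i = 1 & x = \sum_i c i *: p i]].

(* Segments and single points count as (degenerate) polygons. *)
Definition polygon (P : set plane) : Prop :=
  exists (n : nat) (p : 'I_n.+1 -> plane), P = convex_hull p.

(* The points of P that are extreme in direction u. *)
Definition face (P : set plane) (u : plane) : set plane :=
  [set x | P x /\ forall y, P y -> dot u y <= dot u x].

(* A side is a face with at least two points, in a nonzero direction (u = 0
   would give P itself). A segment is its own unique side; a single point has
   no side. *)
Definition side (P F : set plane) : Prop :=
  exists u : plane, [/\ u != 0, F = face P u
    & exists x y, [/\ F x, F y & x != y]].

(* A line through the origin is a subspace of dimension 1. *)
Definition lines (L : {fset {vspace plane}}) : Prop :=
  forall l, l \in L -> \dim l = 1%N.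

Definition parallel (F : set plane) (l : {vspace plane}) : Prop :=
  forall x y, F x -> F y -> x - y \in l.

Definition polygons (L : {fset {vspace plane}}) : set (set plane) :=
  [set P | polygon P /\
    forall F, side P F -> exists2 l, l \in L & parallel F l].

(* The collection is a family indexed by the vertices: the class is closed
   under isomorphism, and a polygon may occur more than once. *)
Definition intersection_graph (C : set (set plane)) (G : sgraph) : Prop :=
  exists f : vertex G -> set plane, (forall v, C (f v)) /\
    forall v w, v != w -> (adj v w <-> f v `&` f w !=set0).

Definition kDIRL_CONV (L : {fset {vspace plane}}) (G : sgraph) : Prop :=
  intersection_graph (polygons L) G.

Definition kDIR_CONV (k : nat) (G : sgraph) : Prop :=
  exists L : {fset {vspace plane}},
    [/\ lines L, #|` L|%fset = k & kDIRL_CONV L G].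

End Plane.

(* Main.v *)
Require Import Defs.
From mathcomp Require Import all_boot reals.
From mathcomp Require Import all_order all_algebra finmap boolp classical_sets.
From mathcomp Require Import ring lra.

(* For each direction l in L, order the plane lexicographically, first across l
   and then along l. Two polygons of P(L) are disjoint iff for some l they span
   disjoint intervals of this order: the difference body has an edge that
   separates it from 0, and this edge is parallel to a side of one of the two
   polygons, unless all differences lie on one ray from 0, when every l works.
   So adjacency is the intersection of k interval graphs. By Helly's property on
   each order, a maximal clique consists of the vertices whose k intervals
   contain k given left endpoints, and these endpoints can be chosen in at most
   n^k ways. *)

Set Implicit Arguments.
Unset Strict Implicit.
Unset Printing Implicit Defensive.

Import Order.TTheory GRing.Theory Num.Theory.

(** * Maximal cliques in an intersection of interval graphs *)

Lemma maximal_cliques_interval_bound (G : sgraph) (I : finType)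
    (d : Order.disp_t) (T : orderType d) (lo hi : I -> vertex G -> T) :
    0 < #|vertex G| ->
    (forall i v, lo i v <= hi i v)%O ->
    (forall v w, v != w ->
       adj v w = [forall i, (lo i v <= hi i w)%O && (lo i w <= hi i v)%O]) ->
  #|maximal_cliques G| <= #|vertex G| ^ #|I|.
Proof.
move=> /card_gt0P[v0 _] lohi adjE.
pose stab (s : {ffun I -> vertex G}) :=
  [set w | [forall i, (lo i w <= lo i (s i))%O && (lo i (s i) <= hi i w)%O]]%SET.
rewrite -card_ffun -cardsT.
apply: leq_trans (leq_imset_card stab _); apply/subset_leq_card/fintype.subsetP => S.
rewrite inE => /maxsetP[/forall_inP cliqueS maxS].
have meet i v w : v \in S -> w \in S -> (lo i v <= hi i w)%O.
  move=> vS wS; have [<-//|vw] := eqVneq v w.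
  have /forall_inP/(_ w wS) := cliqueS v vS.
  by rewrite vw adjE// => /forallP/(_ i)/andP[].
(* The empty set is not maximal, since the singleton of [v0] is a clique. *)
have [w0 w0S] : exists w, w \in S.
  have [S0|] := eqVneq S finset.set0; last by case/set0Pn => w; exists w.
  suff e : [set v0]%SET = S by exists v0; rewrite -e inE.
  apply: maxS; last by rewrite S0 finset.sub0set.
  apply/forall_inP => x /set1P->; apply/forall_inP => y /set1P->.
  by rewrite eqxx.
pose s := [ffun i => [arg max_(v > w0 in S) lo i v]%O].
have sP i : s i \in S /\ forall w, w \in S -> (lo i w <= lo i (s i))%O.
  by rewrite ffunE; case: arg_maxP.
apply/imsetP; exists s; first by rewrite inE.
(* By maximality it suffices that [stab s] contains [S] and is a clique; the latter holds since all
   its intervals for [i] share the point [lo i (s i)]. *)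
apply/esym/maxS.
  apply/forall_inP => v; rewrite inE => /forallP vs.
  apply/forall_inP => w; rewrite inE => /forallP ws.
  apply/implyP => vw; rewrite adjE//; apply/forallP => i.
  have /andP[v1 v2] := vs i; have /andP[w1 w2] := ws i.
  by rewrite (le_trans v1 w2) (le_trans w1 v2).
apply/fintype.subsetP => w wS; rewrite inE; apply/forallP => i.
by have [siS ->//] := sP i; rewrite meet.
Qed.

(** * Scalar products, determinants and the lexicographic order *)

Section Dot.
Local Open Scope ring_scope.
Local Open Scope classical_set_scope.
Variable R : realType.
Implicit Types (u x y z t : plane R).

Lemma dotE u x : dot u x = u 0 0 * x 0 0 + u 0 1 * x 0 1.
Proof. by rewrite /dot big_ord_recl big_ord1; congr (_ + u 0 _ * x 0 _); apply/val_inj. Qed.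

Lemma planeP x y : x 0 0 = y 0 0 -> x 0 1 = y 0 1 -> x = y.
Proof.
move=> e0 e1; apply/rowP => i.
by case: (unliftP 0 i) => [j ->|->//]; rewrite ord1; have -> : lift 0 0 = 1 :> 'I_2 by apply/val_inj.
Qed.

Lemma dotB u x y : dot u (x - y) = dot u x - dot u y.
Proof. by rewrite !dotE !mxE; ring. Qed.

Lemma dotZ u a x : dot u (a *: x) = a * dot u x.
Proof. by rewrite !dotE !mxE; ring. Qed.

Lemma dotN u x : dot u (- x) = - dot u x.
Proof. by rewrite !dotE !mxE; ring. Qed.

Lemma dotC u x : dot u x = dot x u.
Proof. by rewrite !dotE; ring. Qed.

Lemma dotZl a u x : dot (a *: u) x = a * dot u x.
Proof. by rewrite !dotE !mxE; ring. Qed.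

Lemma dotNl u x : dot (- u) x = - dot u x.
Proof. by rewrite !dotE !mxE; ring. Qed.

Lemma dot0l x : dot 0 x = 0.
Proof. by rewrite !dotE !mxE; ring. Qed.

Lemma dot_sum u (I : finType) (F : I -> plane R) :
  dot u (\sum_i F i) = \sum_i dot u (F i).
Proof.
rewrite /dot exchange_big; apply: eq_bigr => j _.
by rewrite summxE mulr_sumr.
Qed.

Lemma dot_gt0 u : u != 0 -> 0 < dot u u.
Proof.
rewrite dotE -!expr2 => u0; rewrite lt_neqAle addr_ge0 ?sqr_ge0// andbT eq_sym.
apply: contra u0; rewrite paddr_eq0 ?sqr_ge0// !sqrf_eq0 => /andP[/eqP u0 /eqP u1].
by apply/eqP/planeP; rewrite mxE.
Qed.

(** Counterclockwise quarter turn; [dot (perp u) x] is the determinant of [u] and [x], positive when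
    [x] lies to the left of [u]. *)
Definition perp u : plane R := \row_i (if i == 0 then - u 0 1 else u 0 0).

Lemma dot_perpE u x : dot (perp u) x = u 0 0 * x 0 1 - u 0 1 * x 0 0.
Proof. by rewrite dotE !mxE/=; ring. Qed.

Lemma dot_perpC u x : dot (perp u) x = - dot (perp x) u.
Proof. by rewrite !dot_perpE; ring. Qed.

(** Expansion in the orthogonal basis [t], [perp t], cleared of denominators. *)
Lemma dot_basis t x : dot t t *: x = dot t x *: t + dot (perp t) x *: perp t.
Proof. by apply: planeP; rewrite dot_perpE !dotE !mxE/=; ring. Qed.

(** Cramer's rule for three vectors of the plane. *)
Lemma dot_perp_relation x y z :
  dot (perp y) z *: x + dot (perp z) x *: y + dot (perp x) y *: z = 0.
Proof. by apply: planeP; rewrite !dot_perpE !mxE/=; ring. Qed.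

(* Position relative to the line spanned by t, ties being broken along it: this
   order also tells apart disjoint collinear segments, which a line parallel to
   t cannot separate. *)
Definition lexkey t x : R *l R := (dot (perp t) x, dot t x).

(** The positive cone of this order: it turns comparisons into signs of differences. *)
Definition lexpos t x : bool :=
  (0 < dot (perp t) x) || ((dot (perp t) x == 0) && (0 < dot t x)).

Lemma lexkey_lt t x y : (lexkey t x < lexkey t y)%O = lexpos t (y - x).
Proof.
rewrite ltEprodlexi/= /lexpos !dotB subr_gt0 subr_eq0 subr_gt0.
by case: (ltgtP (dot (perp t) x)).
Qed.

Lemma lexpos_scale t a x : 0 < a -> lexpos t (a *: x) = lexpos t x.
Proof.
by move=> a0; rewrite /lexpos !dotZ !pmulr_rgt0// mulf_eq0 gt_eqF.
Qed.

Lemma lexpos_total t x : t != 0 -> x != 0 -> lexpos t x || lexpos t (- x).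
Proof.
move=> t0 x0; rewrite /lexpos !dotN !oppr_gt0 oppr_eq0.
case: ltgtP => //= c0; case: ltgtP => //= e0.
have := dot_basis t x; rewrite -c0 -e0 !scale0r addr0 => /eqP.
by rewrite scaler_eq0 gt_eqF ?dot_gt0//= (negbTE x0).
Qed.

End Dot.

(** * Extremes of convex hulls in the lexicographic order *)

Section Hull.
Local Open Scope ring_scope.
Local Open Scope classical_set_scope.
Variable R : realType.
Implicit Types (u x y z t : plane R).

Lemma hull_vertex n (p : 'I_n -> plane R) i : convex_hull p (p i).
Proof.
exists (fun j => (j == i)%:R); split=> [j||].
- exact: ler0n.
- by rewrite (bigD1 i)//= eqxx big1 ?addr0// => j /negbTE->.
- rewrite (bigD1 i)//= eqxx scale1r big1 ?addr0// => j /negbTE->.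
  exact: scale0r.
Qed.

Lemma sum_scale_sub (I : finType) (c : I -> R) (d : I -> plane R) y :
  \sum_i c i = 1 -> \sum_i c i *: d i - y = \sum_i c i *: (d i - y).
Proof.
move=> c1; under [RHS]eq_bigr do rewrite scalerBr.
by rewrite sumrB -scaler_suml c1 scale1r.
Qed.

Lemma hull_dot_le n (p : 'I_n -> plane R) u m x :
  (forall i, dot u (p i) <= m) -> convex_hull p x -> dot u x <= m.
Proof.
move=> pm [c [c0 c1 ->]]; rewrite dot_sum -[m]mul1r -c1 mulr_suml.
by apply: ler_sum => i _; rewrite dotZ ler_wpM2l.
Qed.

(* If the primary coordinate of the combination vanishes, so do those of all
   terms of positive weight, whose secondary coordinates are thus <= 0. *)
Lemma not_lexpos_comb (I : finType) (c : I -> R) (d : I -> plane R) t :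
  (forall i, 0 <= c i) -> (forall i, ~~ lexpos t (d i)) ->
  ~~ lexpos t (\sum_i c i *: d i).
Proof.
move=> c0 dn.
have d1 i : dot (perp t) (d i) <= 0.
  by have := dn i; rewrite negb_or -leNgt => /andP[].
have dotc u : dot u (\sum_i c i *: d i) = - \sum_i c i * - dot u (d i).
  by rewrite dot_sum -sumrN; apply: eq_bigr => i _; rewrite dotZ mulrN opprK.
have cd i : 0 <= c i * - dot (perp t) (d i) by rewrite mulr_ge0// oppr_ge0.
rewrite /lexpos negb_or negb_and !dotc oppr_gt0 -leNgt sumr_ge0//=.
rewrite oppr_eq0 oppr_gt0 -leNgt -implybE.
apply/implyP; rewrite psumr_eq0// => /allP e0.
apply: sumr_ge0 => i _; have := e0 i (mem_index_enum i).
rewrite mulf_eq0 oppr_eq0 => /orP[/eqP->|/eqP e]; first by rewrite mul0r.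
have := dn i; rewrite /lexpos e ltxx eqxx /= -leNgt => ti.
by rewrite mulr_ge0// oppr_ge0.
Qed.

(** Extremes among the generators remain extreme on the hull, because differences with [x] are
    convex combinations of differences with generators. *)
Lemma hull_lex_extremes n (p : 'I_n.+1 -> plane R) t :
  exists i j, forall x, convex_hull p x ->
    (lexkey t (p i) <= lexkey t x <= lexkey t (p j))%O.
Proof.
case: (arg_minP (fun i => lexkey t (p i)) (erefl : xpredT (ord0 : 'I_n.+1))) => i _ mini.
case: (arg_maxP (fun i => lexkey t (p i)) (erefl : xpredT (ord0 : 'I_n.+1))) => j _ maxj.
exists i, j => x [c [c0 c1 ->]]; rewrite !leNgt !lexkey_lt.
rewrite sum_scale_sub// -[p i - _]opprB sum_scale_sub// -sumrN.
under eq_bigr do rewrite -scalerN opprB.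
by rewrite !not_lexpos_comb// => l; rewrite -lexkey_lt -leNgt; [exact: mini | exact: maxj].
Qed.

Lemma hull_lex_lt n m (p : 'I_n.+1 -> plane R) (q : 'I_m.+1 -> plane R) t x y :
  (forall i j, lexkey t (p i) < lexkey t (q j))%O ->
  convex_hull p x -> convex_hull q y -> (lexkey t x < lexkey t y)%O.
Proof.
move=> pq px qy; have [_ [i /(_ x px)/andP[_ xi]]] := hull_lex_extremes p t.
have [j [_ /(_ y qy)/andP[jy _]]] := hull_lex_extremes q t.
exact: le_lt_trans xi (lt_le_trans (pq i j) jy).
Qed.

End Hull.

(** * Separating a finite set of points from the origin *)

Section Separation.
Local Open Scope ring_scope.
Local Open Scope classical_set_scope.
Variable R : realType.
Variables (I : finType) (d : I -> plane R).
Hypothesis zero_notin_hull : forall c : I -> R, (forall i, 0 <= c i) ->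
  \sum_i c i = 1 -> \sum_i c i *: d i != 0.

Lemma zero_notin_triangle i j k a b c : 0 <= a -> 0 <= b -> 0 <= c ->
  0 < a + b + c -> a *: d i + b *: d j + c *: d k != 0.
Proof.
move=> a0 b0 c0 s0; set s := a + b + c in s0.
have sumD (V : nmodType) (F : I -> V) l : \sum_m (if m == l then F m else 0) = F l.
  by rewrite -big_mkcond big_pred1_eq.
(* The weights are added up because [i], [j], [k] may coincide. *)
pose w m := s^-1 * ((if m == i then a else 0) + (if m == j then b else 0)
  + (if m == k then c else 0)).
have w0 m : 0 <= w m.
  by rewrite mulr_ge0 ?invr_ge0 ?(ltW s0)// !addr_ge0//; case: ifP.
have w1 : \sum_m w m = 1.
  rewrite -mulr_sumr !big_split/= !(sumD _ (fun=> _)).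
  by rewrite mulVf// gt_eqF.
have := zero_notin_hull w0 w1.
have -> : \sum_m w m *: d m = s^-1 *: (a *: d i + b *: d j + c *: d k).
  under eq_bigr do rewrite -scalerA !scalerDl !(fun_if (fun r => r *: _)) !scale0r.
  by rewrite -scaler_sumr !big_split/= !(sumD _ (fun m => _ *: d m)).
by apply: contra => /eqP->; rewrite scaler0.
Qed.

(** As the hull avoids 0, the directions of the points can be compared by angle; [i] is the most
    clockwise one, found by scanning the points. *)
Lemma angular_extreme (i0 : I) : exists i, forall j, 0 <= dot (perp (d i)) (d j).
Proof.
suff [i ih] : exists i, forall j, j \in enum I -> 0 <= dot (perp (d i)) (d j).
  by exists i => j; rewrite ih ?mem_enum.
elim: (enum I) => [|k s [i ih]]; first by exists i0.
have dd l : dot (perp (d l)) (d l) = 0 by rewrite dot_perpE; ring.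
have [ik|ik] := leP 0 (dot (perp (d i)) (d k)).
  by exists i => j; rewrite inE => /predU1P[->//|/ih].
exists k => j; rewrite inE => /predU1P[->|js]; first by rewrite dd.
rewrite leNgt; apply/negP => kj.
have ij := ih _ js.
(* If [j] were clockwise of [k], the coefficients in Cramer's relation would be nonnegative and not
   all zero, putting 0 in the triangle. *)
have := @zero_notin_triangle i j k (dot (perp (d j)) (d k))
  (dot (perp (d k)) (d i)) (dot (perp (d i)) (d j)).
rewrite dot_perp_relation eqxx => H; suff : false by [].
have := dot_perpC (d j) (d k); have := dot_perpC (d k) (d i).
by move=> *; apply: H => //; lra.
Qed.

(* Either an edge of the hull separates the hull from 0, or all points lie on
   one open ray from 0. The edge starts at the point closest to 0 on the
   extreme ray. *)
Lemma visible_edge_or_ray (i0 : I) :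
  (exists u m i j, [/\ 0 < m, d i != d j, dot u (d i) = m, dot u (d j) = m
     & forall l, m <= dot u (d l)]) \/
  (exists2 z, z != 0 & forall l, exists2 a, 0 < a & d l = a *: z).
Proof.
have [i ext] := angular_extreme i0.
have d0 l : d l != 0.
  apply/eqP => e; have := @zero_notin_triangle l l l 1 0 0 ler01 (lexx 0) (lexx 0).
  by rewrite !addr0 e scaler0 !scale0r !addr0 eqxx => /(_ ltr01).
have ray l : dot (perp (d i)) (d l) = 0 -> 0 < dot (d i) (d l).
  move=> c0; rewrite ltNge; apply/negP => e0.
  have := @zero_notin_triangle l i i (dot (d i) (d i)) (- dot (d i) (d l)) 0.
  have ii := dot_gt0 (d0 i).
  rewrite dot_basis c0 !scale0r !addr0 scaleNr addrN eqxx => H.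
  by suff: false by []; apply: H => //; lra.
have ii0 : dot (perp (d i)) (d i) == 0 by rewrite dot_perpE; apply/eqP; ring.
have [noPos|] := boolP [forall l, dot (perp (d i)) (d l) == 0].
  right; exists (d i) => // l; have /eqP c0 := forallP noPos l.
  have ii := dot_gt0 (d0 i).
  exists ((dot (d i) (d i))^-1 * dot (d i) (d l)).
    by rewrite mulr_gt0 ?invr_gt0// ray.
  rewrite -scalerA -[dot _ _ *: d i]addr0 -[X in _ + X](scale0r (perp (d i))).
  by rewrite -c0 -dot_basis scalerA mulVf ?scale1r// gt_eqF.
rewrite negb_forall => /existsP[j0 j0n]; left.
case: (@arg_minP _ _ _ i (fun l => dot (perp (d i)) (d l) == 0)
  (fun l => dot (d i) (d l)) ii0) => i1 /eqP i1c mini.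
set m := dot (d i) (d i1) in mini.
(* With [u = d i + s *: perp (d i)], the bound [m <= dot u (d l)] off the extreme ray says that [s]
   is at least this ratio. The maximum is attained at the other end [j] of the edge. *)
case: (@arg_maxP _ _ _ j0 (fun l => dot (perp (d i)) (d l) != 0)
  (fun l => (m - dot (d i) (d l)) / dot (perp (d i)) (d l)) j0n) => j jc maxj.
set s := (m - _) / _ in maxj.
have uE l : dot (d i + s *: perp (d i)) (d l)
    = dot (d i) (d l) + s * dot (perp (d i)) (d l).
  by rewrite !dotE !mxE; ring.
exists (d i + s *: perp (d i)), m, i1, j; split.
- exact: ray.
- by apply: contra jc => /eqP<-; rewrite i1c.
- by rewrite uE i1c mulr0 addr0.
- by rewrite uE /s divfK// addrC subrK.
- move=> l; rewrite uE; have [lc|lc] := eqVneq (dot (perp (d i)) (d l)) 0.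
    by rewrite lc mulr0 addr0 mini// lc.
  have /= := maxj _ lc; rewrite ler_pdivrMr ?lt_neqAle ?ext 1?eq_sym ?lc//.
  by rewrite lerBlDl.
Qed.

End Separation.

(** * Separating disjoint polygons along a line of [L] *)

Section Polygons.
Local Open Scope ring_scope.
Local Open Scope classical_set_scope.
Variable R : realType.
Implicit Types (u x y z t : plane R) (L : {fset {vspace (plane R)}}).

(** If the combination vanished, the two marginals of [c] would represent a common point of the
    hulls. *)
Lemma disjoint_hulls_zero n m (p : 'I_n -> plane R) (q : 'I_m -> plane R)
    (c : 'I_n * 'I_m -> R) :
  ~ (convex_hull p `&` convex_hull q !=set0) ->
  (forall i, 0 <= c i) -> \sum_i c i = 1 ->
  \sum_i c i *: (p i.1 - q i.2) != 0.
Proof.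
move=> dis c0 c1; apply/eqP => e; apply: dis.
exists (\sum_i (\sum_j c (i, j)) *: p i); split.
  exists (fun i => \sum_j c (i, j)); split=> // [i|].
    exact: sumr_ge0.
  by rewrite pair_bigA -[RHS]c1; apply: eq_bigr => -[].
exists (fun j => \sum_i c (i, j)); split=> [j||].
- exact: sumr_ge0.
- by rewrite exchange_big pair_bigA -[RHS]c1; apply: eq_bigr => -[].
apply/eqP; rewrite -subr_eq0 -[X in _ == X]e; apply/eqP.
under [X in X - _]eq_bigr do rewrite scaler_suml.
under [X in _ - X]eq_bigr do rewrite scaler_suml.
rewrite [X in _ - X]exchange_big !pair_bigA -sumrB.
by apply: eq_bigr => -[i j] _; rewrite scalerBr.
Qed.

Lemma side_line L n (p : 'I_n -> plane R) u i j :
  polygons L (convex_hull p) -> u != 0 -> p i != p j ->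
  dot u (p i) = dot u (p j) -> (forall l, dot u (p l) <= dot u (p i)) ->
  exists2 l, l \in L & p i - p j \in l.
Proof.
move=> [_ sideL] u0 ij e maxi.
have Fi : face (convex_hull p) u (p i).
  by split=> [|y]; [exact: hull_vertex | exact: hull_dot_le].
have Fj : face (convex_hull p) u (p j).
  by split=> [|y]; [exact: hull_vertex | rewrite -e; exact: hull_dot_le].
have [|l lL par] := sideL (face (convex_hull p) u).
  by exists u; split=> //; exists (p i), (p j); split.
by exists l => //; exact: par.
Qed.

(** In the plane the vectors orthogonal to [l] are the multiples of [perp (vpick l)]. *)
Lemma orthogonal_perp_line (l : {vspace (plane R)}) u x :
  \dim l = 1%N -> x \in l -> x != 0 -> dot u x = 0 ->
  exists b, forall y, dot u y = b * dot (perp (vpick l)) y.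
Proof.
move=> l1 xl x0 ux; set t := vpick l.
have lE : l = <[x]>%VS.
  by apply/esym/eqP; rewrite eqEdim -memvE xl dim_vline x0 l1.
have /vlineP[a ta] : t \in <[x]>%VS by rewrite -lE memv_pick.
have tu : dot t u = 0 by rewrite dotC ta dotZ ux mulr0.
have tt : 0 < dot t t by rewrite dot_gt0// vpick0 -dimv_eq0 l1.
exists (dot (perp t) u / dot t t) => y; apply: (mulfI (lt0r_neq0 tt)).
by rewrite /= -[LHS]dotZl dot_basis tu scale0r add0r dotZl mulrA [dot t t * _]mulrC divfK ?gt_eqF.
Qed.

Lemma lexpos_uniform (I : finType) (d : I -> plane R) t :
  t != 0 -> (exists2 z, z != 0 & forall i, exists2 a, 0 < a & d i = a *: z) ->
  (forall i, lexpos t (d i)) \/ (forall i, lexpos t (- d i)).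
Proof.
move=> t0 [z z0 dz]; have /orP[zt|zt] := lexpos_total t0 z0; [left|right] => i.
  by have [a a0 ->] := dz i; rewrite lexpos_scale.
by have [a a0 ->] := dz i; rewrite -scalerN lexpos_scale.
Qed.

Lemma disjoint_polygons_separated L n m (p : 'I_n.+1 -> plane R)
    (q : 'I_m.+1 -> plane R) :
  lines L -> L != fset0 ->
  polygons L (convex_hull p) -> polygons L (convex_hull q) ->
  ~ (convex_hull p `&` convex_hull q !=set0) ->
  exists2 l, l \in L &
    (forall x y, convex_hull p x -> convex_hull q y ->
       lexkey (vpick l) y < lexkey (vpick l) x)%O \/
    (forall x y, convex_hull p x -> convex_hull q y ->
       lexkey (vpick l) x < lexkey (vpick l) y)%O.
Proof.
move=> lineL /fset0Pn[l0 l0L] pL qL dis.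
have pick0 l : l \in L -> vpick l != 0.
  by move=> /lineL l1; rewrite vpick0 -dimv_eq0 l1.
have sgn l : (forall ij, lexpos (vpick l) (p ij.1 - q ij.2)) \/
     (forall ij, lexpos (vpick l) (- (p ij.1 - q ij.2))) ->
    (forall x y, convex_hull p x -> convex_hull q y ->
       lexkey (vpick l) y < lexkey (vpick l) x)%O \/
    (forall x y, convex_hull p x -> convex_hull q y ->
       lexkey (vpick l) x < lexkey (vpick l) y)%O.
  case=> H; [left=> x y px qy|right=> x y px qy].
    apply: (hull_lex_lt _ qy px) => j i; rewrite lexkey_lt.
    exact: (H (i, j)).
  apply: (hull_lex_lt _ px qy) => i j; rewrite lexkey_lt -opprB.
  exact: (H (i, j)).
have [[u [mu [[i1 j1] [[i2 j2] [/= mu0 ne e1 e2 minu]]]]]|ray] :=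
    @visible_edge_or_ray _ _ (fun ij => p ij.1 - q ij.2)
      (fun c => disjoint_hulls_zero dis) (ord0, ord0); last first.
  by exists l0 => //; apply/sgn/lexpos_uniform; rewrite ?pick0.
have u0 : u != 0.
  by apply/eqP => u0; move: mu0; rewrite -e1 u0 dot0l ltxx.
have gap i j : mu <= dot u (p i) - dot u (q j) by rewrite -dotB; exact: (minu (i, j)).
rewrite !dotB in e1 e2.
(* A difference minimises [u] only if its [p] part minimises and its [q] part maximises [u]. *)
have minp i : dot u (p i1) <= dot u (p i) by have := gap i j1; lra.
have maxq j : dot u (q j) <= dot u (q j1) by have := gap i1 j; lra.
have ep : dot u (p i1) = dot u (p i2).
  by have := gap i1 j2; have := gap i2 j1; lra.
have eq : dot u (q j1) = dot u (q j2) by lra.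
have [l lL [x [xl x0 ux]]] : exists2 l, l \in L &
    exists x, [/\ x \in l, x != 0 & dot u x = 0].
  (* The ends of the edge differ, so one of the polygons has a side parallel to it; for [p] the
     outer normal is [- u]. *)
  have [pe|pne] := eqVneq (p i1) (p i2).
    have qne : q j1 != q j2 by apply: contra ne => /eqP->; rewrite pe.
    have [l lL ql] := side_line qL u0 qne eq maxq.
    by exists l => //; exists (q j1 - q j2); rewrite subr_eq0 dotB eq subrr.
  have [||i|l lL pl] := @side_line L _ p (- u) i1 i2 pL _ pne.
  - by rewrite oppr_eq0.
  - by rewrite !dotNl ep.
  - by rewrite !dotNl lerN2.
  by exists l => //; exists (p i1 - p i2); rewrite subr_eq0 dotB ep subrr.
exists l => //; apply: sgn; rewrite /lexpos.
have tt := dot_gt0 (pick0 l lL).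
have [b ub] := orthogonal_perp_line (lineL l lL) xl x0 ux.
(* The sign of [b] decides which polygon comes first; [b = 0] would contradict [0 < mu]. *)
have [b0|b0|b0] := ltgtP b 0.
- right=> -[i j] /=; rewrite dotN oppr_gt0 -(nmulr_rgt0 _ b0) -ub dotB.
  by rewrite (lt_le_trans mu0 (gap _ _)).
- left=> -[i j] /=; rewrite -(pmulr_rgt0 _ b0) -ub dotB.
  by rewrite (lt_le_trans mu0 (gap _ _)).
- by move: mu0; have := gap i1 j1; rewrite -dotB ub b0 mul0r; lra.
Qed.

End Polygons.

(** * From polygons to intervals in [k] orders *)

Theorem theorem3 (R : realType) (k : nat) (hk : 0 < k) (G : sgraph)
  (hG : 0 < #|vertex G|) (hC : kDIR_CONV R k G) :
  #|maximal_cliques G| <= #|vertex G| ^ k.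
Proof.
case: hC => L [lineL cardL [f [fL adjf]]].
have L0 : L != fset0 by rewrite -cardfs_gt0 cardL.
(* The interval endpoints are keys of points of the polygon itself, so a separation of two polygons
   applies to them. *)
have ext (iv : L * vertex G) : exists lh : plane R * plane R,
    [/\ f iv.2 lh.1, f iv.2 lh.2 & forall x, f iv.2 x ->
      (lexkey (vpick (val iv.1)) lh.1 <= lexkey (vpick (val iv.1)) x
        <= lexkey (vpick (val iv.1)) lh.2)%O].
  have [[n [p pE]] _] := fL iv.2.
  have [i [j H]] := hull_lex_extremes p (vpick (val iv.1)).
  by exists (p i, p j); rewrite pE; split=> //; exact: hull_vertex.
have [e eP] := choice ext.
pose lo (l : L) v := lexkey (vpick (val l)) (e (l, v)).1.
pose hi (l : L) v := lexkey (vpick (val l)) (e (l, v)).2.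
rewrite -cardL cardfE.
apply: (@maximal_cliques_interval_bound G L _ _ lo hi) => // [l v|v w vw].
  by have [lov _ /(_ _ lov)/andP[]] := eP (l, v).
apply/idP/forallP => [/(adjf v w vw)[x [vx wx]] l|meet].
  have [_ _ /(_ x vx)/andP[v1 v2]] := eP (l, v).
  have [_ _ /(_ x wx)/andP[w1 w2]] := eP (l, w).
  by rewrite (le_trans v1 w2) (le_trans w1 v2).
apply/(adjf v w vw); apply: contrapT => dis.
have [[n [p pE]] _] := fL v; have [[m [q qE]] _] := fL w.
have := disjoint_polygons_separated lineL L0 (p := p) (q := q).
rewrite -pE -qE => /(_ (fL v) (fL w) dis)[l lL sep].
have /andP[] := meet [` lL]%fset; rewrite /lo /hi /=.
have [/= ev1 ev2 _] := eP ([` lL]%fset, v).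
have [/= ew1 ew2 _] := eP ([` lL]%fset, w).
by case: sep => [/(_ _ _ ev1 ew2)|/(_ _ _ ev2 ew1)]; rewrite ltNge => /negP.
Qed.
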